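(* Let $\Gamma=\langle\mathcal{A},\mathcal{R}\rangle$ be an AFRA which is an AF, i.e. $\mathcal{R}\subseteq\mathcal{A}\times\mathcal{A}$, and let $\mathcal{S}\subseteq\mathcal{A}\cup\mathcal{R}$. Then $\mathcal{S}$ is a preferred extension of $\Gamma$ if and only if $\mathcal{S}=\mathcal{U}^{\rightarrow AFRA}$ for some $\mathcal{U}\subseteq\mathcal{A}$ which is a D-preferred extension of $\Gamma$.
   Context: An AFRA (Argumentation Framework with Recursive Attacks) is a pair $\langle\mathcal{A},\mathcal{R}\rangle$ where $\mathcal{A}$ is a set (of arguments) and $\mathcal{R}$ is a set of attacks, each attack being a pair $\alpha=(A,X)$ with $A\in\mathcal{A}$ and ($X\in\mathcal{R}$ or $X\in\mathcal{A}$); $A=src(\alpha)$ is its source and $X=trg(\alpha)$ its target. Arguments and attacks are distinct objects ($\mathcal{A}\cap\mathcal{R}=\emptyset$). Defeat: for $\alpha\in\mathcal{R}$, $V\in\mathcal{A}\cup\mathcal{R}$, $\alpha$ directly defeats $V$ iff $V=trg(\alpha)$; $\alpha$ indirectly defeats $\beta\in\mathcal{R}$ iff $\alpha$ directly defeats $src(\beta)$; $\alpha\rightarrow_R V$ ($\alpha$ defeats $V$) iff $\alpha$ directly or indirectly defeats $V$. Only attacks can defeat. A set $\mathcal{S}\subseteq\mathcal{A}\cup\mathcal{R}$ is conflict-free iff there are no $V,W\in\mathcal{S}$ with $V\rightarrow_R W$. $W\in\mathcal{A}\cup\mathcal{R}$ is acceptable w.r.t. $\mathcal{S}$ iff for every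 $\alpha\in\mathcal{R}$ with $\alpha\rightarrow_R W$ there is $\beta\in\mathcal{S}$ with $\beta\rightarrow_R\alpha$. $\mathcal{S}$ is admissible iff it is conflict-free and each of its elements is acceptable w.r.t. $\mathcal{S}$. $\mathcal{S}$ is a preferred extension iff it is a maximal (w.r.t. set inclusion) admissible set. Dung notions (for $\Gamma$ viewed as a Dung argumentation framework with set of arguments $\mathcal{A}$ and attack relation $\mathcal{R}\subseteq\mathcal{A}\times\mathcal{A}$): $\mathcal{U}\subseteq\mathcal{A}$ is D-conflict-free if there are no $A,B\in\mathcal{U}$ with $(A,B)\in\mathcal{R}$; $A\in\mathcal{A}$ is D-acceptable w.r.t. $\mathcal{U}$ if for all $B\in\mathcal{A}$ with $(B,A)\in\mathcal{R}$ there is $C\in\mathcal{U}$ with $(C,B)\in\mathcal{R}$; $\mathcal{U}$ is D-admissible if it is D-conflict-free and each of its elements is D-acceptable w.r.t. $\mathcal{U}$; $\mathcal{U}$ is a D-preferred extension if it is a maximal (w.r.t. set inclusion) D-admissible set. For $\mathcal{U}\subseteq\mathcal{A}$, $\mathcal{U}^{\rightarrow AFRA}:=\mathcal{U}\cup\{\alpha\in\mathcal{R}\mid src(\alpha)\in\mathcal{U}\}$. *)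

(* Defs.v *)
From mathcomp Require Import all_boot all_classical.

Set Implicit Arguments.
Unset Strict Implicit.
Unset Printing Implicit Defensive.

Local Open Scope classical_set_scope.

(* The arguments of a framework are drawn from an arbitrary type T. Since an
   attack is a pair (A, X) whose target X may itself be an attack, arguments
   and attacks both live in the inductive type obj T; the two constructors
   make them distinct objects. *)
Inductive obj (T : Type) : Type :=
| Arg of T
| Att of (T * obj T).
Arguments Arg {T} _.
Arguments Att {T} _.

Definition attack (T : Type) : Type := (T * obj T)%type.

Definition src (T : Type) (alpha : attack T) : T := alpha.1.
Definition trg (T : Type) (alpha : attack T) : obj T := alpha.2.

Record afra (T : Type) : Type := Afra {
  args : set T;
  atts : set (attack T);
  src_args : forall alpha, atts alpha -> args (src alpha);
  trg_objs : forall alpha, atts alpha ->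
    (Arg @` args `|` Att @` atts) (trg alpha)
}.

Section AFRA.
Context {T : Type}.
Implicit Types (G : afra T) (alpha beta : attack T) (V W : obj T).
Implicit Types (S : set (obj T)) (U : set T).

(* The union of the arguments and the attacks. *)
Definition objs G : set (obj T) := Arg @` args G `|` Att @` atts G.

Definition is_AF G : Prop :=
  atts G `<=` [set (A, Arg B) | A in args G & B in args G].

Definition directly_defeats G alpha V : Prop :=
  [/\ atts G alpha, objs G V & V = trg alpha].

Definition indirectly_defeats G alpha beta : Prop :=
  atts G beta /\ directly_defeats G alpha (Arg (src beta)).

Definition defeats G alpha V : Prop :=
  directly_defeats G alpha V \/
  exists2 beta, V = Att beta & indirectly_defeats G alpha beta.

Definition conflict_free G S : Prop :=
  ~ exists alpha W, [/\ S (Att alpha), S W & defeats G alpha W].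

Definition acceptable G W S : Prop :=
  forall alpha, atts G alpha -> defeats G alpha W ->
  exists2 beta, S (Att beta) & defeats G beta (Att alpha).

Definition admissible G S : Prop :=
  [/\ S `<=` objs G, conflict_free G S & forall W, S W -> acceptable G W S].

Definition preferred G S : Prop :=
  admissible G S /\ forall S', admissible G S' -> S `<=` S' -> S' = S.

(* Dung's notions only see the attacks between arguments; they are meant for
   frameworks satisfying is_AF. *)
Definition D_conflict_free G U : Prop :=
  ~ exists A B, [/\ U A, U B & atts G (A, Arg B)].

Definition D_acceptable G (A : T) U : Prop :=
  forall B, args G B -> atts G (B, Arg A) ->
  exists2 C, U C & atts G (C, Arg B).

Definition D_admissible G U : Prop :=
  [/\ U `<=` args G, D_conflict_free G U & forall A, U A -> D_acceptable G A U].

Definition D_preferred G U : Prop :=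
  D_admissible G U /\ forall U', D_admissible G U' -> U `<=` U' -> U' = U.

Definition to_AFRA G U : set (obj T) :=
  Arg @` U `|` Att @` [set alpha | atts G alpha /\ U (src alpha)].

End AFRA.

(* Main.v *)
Require Import Defs.
From mathcomp Require Import all_boot all_classical.
Local Open Scope classical_set_scope.

(* Let the host of an argument be itself and that of an attack its source. In
   an AF, an attack defeats V exactly when its target is the host of V, so
   taking hosts and [to_AFRA] form a monotone Galois insertion between sets of
   objects and sets of arguments. Both maps preserve admissibility, hence they
   exchange the maximal admissible sets. *)

Definition host {T : Type} (V : obj T) : T :=
  match V with Arg A => A | Att alpha => src alpha end.

Section Host.
Context {T : Type}.
Implicit Types (G : afra T) (U : set T) (S : set (obj T)).

Lemma host_args G V : objs G V -> args G (host V).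
Proof. by move=> [[A GA <-]|[alpha Ga <-]] //=; exact: src_args. Qed.

(** This form treats arguments and attacks uniformly, so the admissibility proof for [to_AFRA] needs
    no case split on the kind of object. *)
Lemma to_AFRAE G U : U `<=` args G ->
  to_AFRA G U = objs G `&` host @^-1` U.
Proof.
move=> UG; apply/seteqP; split=> [V|V [] []].
- move=> [[A UA <-]|[alpha [Ga Ua] <-]]; split=> //.
  + by left; exists A => //; exact: UG.
  + by right; exists alpha.
- by move=> [A GA <-] UA; left; exists A.
- by move=> [alpha Ga <-] Ua; right; exists alpha.
Qed.

Lemma host_to_AFRA G U : host @` to_AFRA G U = U.
Proof.
apply/seteqP; split=> [A|A UA].
- by move=> [V [[B UB <-]|[alpha [_ Ua] <-]] <-].
- by exists (Arg A) => //; left; exists A.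
Qed.

Lemma to_AFRAS G U U' : U `<=` U' -> to_AFRA G U `<=` to_AFRA G U'.
Proof.
move=> UU' V [[A UA <-]|[alpha [Ga Ua] <-]].
- by left; exists A => //; exact: UU'.
- by right; exists alpha => //; split=> //; exact: UU'.
Qed.

Lemma host_sub_args G S : S `<=` objs G -> host @` S `<=` args G.
Proof. by move=> SG _ [V SV <-]; apply/host_args/SG. Qed.

Lemma sub_to_AFRA_host G S : S `<=` objs G -> S `<=` to_AFRA G (host @` S).
Proof.
move=> SG V SV; rewrite to_AFRAE; last exact: host_sub_args.
by split; [exact: SG | exists V].
Qed.

(** Targets in an AF are arguments, so a direct defeat hits an argument, which is its own host; an
    attack can only be defeated indirectly, through its source. *)
Lemma defeatsE {G alpha V} : is_AF G -> objs G V ->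
  defeats G alpha V <-> atts G alpha /\ trg alpha = Arg (host V).
Proof.
move=> AF GV; split.
- move=> [[Ga _ ->]|[beta -> [_ [Ga _ <-]]] //].
  by split=> //; have [A _ [B _ <-]] := AF _ Ga.
- move=> [Ga ta]; case: V GV ta => [A|beta] GV /= ta; first by left.
  right; exists beta => //; case: (GV) => [[]//|[gamma + [E]]].
  by rewrite E => Gb; split=> //; split=> //; left; exists (src beta) => //;
    exact: host_args GV.
Qed.

Lemma admissible_to_AFRA G U : is_AF G ->
  D_admissible G U -> admissible G (to_AFRA G U).
Proof.
move=> AF [UG Ucf Uacc]; rewrite to_AFRAE //; split; first by move=> V [].
- move=> [[A X] [W [[_ UA] [GW UW]]]].
  move=> /(defeatsE AF GW)[/= Ga tX]; apply: Ucf; exists A, (host W).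
  by split=> //; rewrite -tX.
- move=> W [GW UW] [B X] GB /(defeatsE AF GW)[_ /= tX]; subst X.
  (* The defending attack [(C, Arg B)] belongs to [to_AFRA G U] because [C] is in [U], and it
     defeats [(B, Arg (host W))] indirectly, through its source [B]. *)
  have [C UC GC] := Uacc _ UW _ (src_args GB) GB.
  exists (C, Arg B); first by split=> //; right; exists (C, Arg B).
  by apply/defeatsE => //; right; exists (B, Arg (host W)).
Qed.

Lemma D_admissible_host G S : is_AF G ->
  admissible G S -> D_admissible G (host @` S).
Proof.
move=> AF [SG Scf Sacc].
(* The attack from [B] defeats [W] and has host [B], so any attack in [S] that defeats it must
   target [B]. *)
have defended W B : S W -> atts G (B, Arg (host W)) ->
    exists2 beta, S (Att beta) & atts G beta /\ trg beta = Arg B.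
  move=> SW GB; have [|beta Sb] := Sacc _ SW _ GB.
    by apply/defeatsE => //; exact: SG.
  by move/defeatsE => /(_ AF) []; [right; exists (B, Arg (host W)) | exists beta].
split; first exact: host_sub_args.
- move=> [_ [_ [[V SV <-] [W SW <-] GVW]]].
  (* The attack itself need not lie in S, but the defence of W against it
     defeats V too. *)
  have [beta Sb [Gb tb]] := defended _ _ SW GVW.
  apply: Scf; exists beta, V; split=> //.
  by apply/defeatsE => //; exact: SG.
- move=> _ [W SW <-] B _ GB.
  have [[C X] Sb [Gb /= tb]] := defended _ _ SW GB; subst X.
  by exists C => //; exists (Att (C, Arg B)).
Qed.

End Host.

Theorem proposition7 (T : Type) (G : afra T) (S : set (obj T))
    (G_AF : is_AF G) (S_objs : S `<=` objs G) :
  preferred G S <->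
  exists U : set T, [/\ U `<=` args G, D_preferred G U & S = to_AFRA G U].
Proof.
split=> [[Sadm Smax]|[U [UG [Uadm Umax] ->]]].
- have Uadm := D_admissible_host _ _ G_AF Sadm.
  have SE : to_AFRA G (host @` S) = S.
    by apply: Smax; [exact: admissible_to_AFRA | exact: sub_to_AFRA_host].
  exists (host @` S); split=> //; first exact: host_sub_args.
  split=> // U' U'adm UU'.
  (* By monotonicity [to_AFRA G U'] contains [S], hence equals it by maximality; taking hosts
     recovers [U']. *)
  rewrite -[LHS](host_to_AFRA G) (Smax (to_AFRA G U')) //.
    exact: admissible_to_AFRA.
  by rewrite -{1}SE; exact: to_AFRAS.
- split=> [|S' S'adm US']; first exact: admissible_to_AFRA.
  apply/seteqP; split=> //.
  (* The hosts of [S'] include those of [to_AFRA G U], which form [U], so maximality of [U] forces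
     equality. *)
  have <- : host @` S' = U.
    apply: Umax; first exact: D_admissible_host.
    by rewrite -{1}(host_to_AFRA G U); exact: image_subset.
  by apply: sub_to_AFRA_host; case: S'adm.
Qed.
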